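(* Let $\mathbb{F}$ be a field and let $n\ge 3$ be an integer. Consider the $n\times n$ partial matrix over $\mathbb{F}$ $$\mathcal{A}=\begin{bmatrix} a_{11} & a_{12} & ? & \cdots & ?\\ ? & a_{22} & a_{23} & \ddots & \vdots\\ \vdots & \ddots & \ddots & \ddots & ?\\ ? & \cdots & ? & a_{n-1,n-1} & a_{n-1,n}\\ a_{n1} & ? & \cdots & ? & a_{nn} \end{bmatrix},$$ whose specified entries are exactly $a_{ii}$ ($1\le i\le n$), $a_{i,i+1}$ ($1\le i\le n-1$) and $a_{n1}$, all in $\mathbb{F}$. Suppose that at least one of the specified entries $a_{ij}$ is zero. Then $$\operatorname{mr}(\mathcal{A})=\operatorname{fmr}(\mathcal{A})=\operatorname{tmr}(\mathcal{A})\le 2.$$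
   Context: A partial matrix over a field $\mathbb{F}$ is an $m\times n$ array $\mathcal{A}$ in which some entries are specified elements of $\mathbb{F}$ and the others are unspecified (denoted $?$). Its pattern of knowns is the set $J\subseteq\{1,\dots,m\}\times\{1,\dots,n\}$ of positions of specified entries. A completion is a matrix over $\mathbb{F}$ obtained by specifying all unspecified entries. The minimal rank $\operatorname{mr}(\mathcal{A})$ is the minimum of $\operatorname{rank} B$ over all completions $B$ of $\mathcal{A}$. The same notions apply to partial block matrices, where an unspecified block may be replaced by any matrix over $\mathbb{F}$ of the appropriate size. For $T\subseteq J$, $\mathcal{A}\mid T$ denotes the partial matrix keeping only the specified entries of $\mathcal{A}$ in positions in $T$ (all other positions are unspecified). A pattern $T$ is triangular if whenever $(i,j)\in T$ and $(k,l)\in T$, then $(i,l)\in T$ or $(k,j)\in T$. A triangular $T\subseteq J$ is a maximal triangular subpattern of $J$ if it is maximal under inclusion among triangular subsets of $J$. The triangular minimal rank is $$\operatorname{tmr}(\mathcal{A})=\max\{\operatorname{mr}(\mathcal{A}\mid T): T\subseteq J \text{ maximal triangular}\}.$$ For $b\in\mathbb{N}$ (positive integers), $\mathcal{A}\otimes I_b$ is the partial block matrix obtained by replacing each specified entry $a_{ij}$ by the block $a_{ij}I_b$ and each unspecified entry by a wholly unspecified $b\times b$ block. The fractional minimal rank is $$\operatorname{fmr}(\mathcal{A})=\inf_{b\in\mathbb{N}}\frac{\operatorname{mr}(\mathcal{A}\otimes I_b)}{b}.$$ *)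

(* Defs.v *)
From HB Require Import structures.
From mathcomp Require Import all_boot all_order all_algebra.
From mathcomp Require Import boolp classical_sets reals.

Set Implicit Arguments.
Unset Strict Implicit.
Unset Printing Implicit Defensive.

Import Order.TTheory GRing.Theory Num.Theory.
Local Open Scope ring_scope.

(* [None] is an unspecified entry. *)
Notation partial_matrix F m n := 'M[option F]_(m, n).

Lemma ex_rank (F : fieldType) m n (P : 'M[F]_(m, n) -> Prop) :
  (exists B, P B) -> exists r, `[< exists2 B, P B & \rank B = r >].
Proof. by case=> B PB; exists (\rank B); apply/asboolP; exists B. Qed.

Definition min_rank (F : fieldType) m n (P : 'M[F]_(m, n) -> Prop)
    (exP : exists B, P B) : nat :=
  ex_minn (ex_rank exP).

Definition pattern (F : fieldType) m n (A : partial_matrix F m n) :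
    {set 'I_m * 'I_n} :=
  [set p | isSome (A p.1 p.2)].

Definition completion (F : fieldType) m n (A : partial_matrix F m n)
    (B : 'M[F]_(m, n)) : Prop :=
  forall i j a, A i j = Some a -> B i j = a.

Lemma ex_completion (F : fieldType) m n (A : partial_matrix F m n) :
  exists B, completion A B.
Proof. by exists (map_mx (odflt 0) A) => i j a; rewrite mxE => ->. Qed.

Definition mr (F : fieldType) m n (A : partial_matrix F m n) : nat :=
  min_rank (ex_completion A).

Definition restrict (F : fieldType) m n (A : partial_matrix F m n)
    (T : {set 'I_m * 'I_n}) : partial_matrix F m n :=
  \matrix_(i, j) if (i, j) \in T then A i j else None.

Definition triangular m n (T : {set 'I_m * 'I_n}) : bool :=
  [forall p in T, forall q in T, ((p.1, q.2) \in T) || ((q.1, p.2) \in T)].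

Definition maximal_triangular m n (J T : {set 'I_m * 'I_n}) : bool :=
  maxset (fun S : {set 'I_m * 'I_n} => (S \subset J) && triangular S) T.

Definition tmr (F : fieldType) m n (A : partial_matrix F m n) : nat :=
  \max_(T : {set 'I_m * 'I_n} | maximal_triangular (pattern A) T)
    mr (restrict A T).

(* Block (i, j) has size p i x q j; [None] is a wholly unspecified block. *)
Definition partial_block_matrix (F : fieldType) m n
    (p : 'I_m -> nat) (q : 'I_n -> nat) : Type :=
  forall i j, option 'M[F]_(p i, q j).

Definition block_completion (F : fieldType) m n
    (p : 'I_m -> nat) (q : 'I_n -> nat) (A : partial_block_matrix F p q)
    (B : 'M[F]_(\sum_i p i, \sum_j q j)) : Prop :=
  forall i j X, A i j = Some X -> submxblock B i j = X.

Lemma ex_block_completion (F : fieldType) m n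
    (p : 'I_m -> nat) (q : 'I_n -> nat) (A : partial_block_matrix F p q) :
  exists B, block_completion A B.
Proof.
exists (\mxblock_(i, j) odflt 0 (A i j)) => i j X AX.
by rewrite mxblockK AX.
Qed.

Definition block_mr (F : fieldType) m n
    (p : 'I_m -> nat) (q : 'I_n -> nat) (A : partial_block_matrix F p q) : nat :=
  min_rank (ex_block_completion A).

Definition tensor_id (F : fieldType) m n (A : partial_matrix F m n) (b : nat) :
    partial_block_matrix F (fun _ : 'I_m => b) (fun _ : 'I_n => b) :=
  fun i j => omap (fun a : F => a%:M) (A i j).

Definition fmr (R : realType) (F : fieldType) m n
    (A : partial_matrix F m n) : R :=
  inf [set (block_mr (tensor_id A b))%:R / b%:R | b in [set b | (0 < b)%N]]%classic.

(* Indices are 0-based: the diagonal, the superdiagonal and the bottom-left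
   corner. *)
Definition cycle_pattern n : {set 'I_n * 'I_n} :=
  [set p : 'I_n * 'I_n | [|| val p.2 == val p.1, val p.2 == (val p.1).+1
                           | ((val p.1).+1 == n) && (val p.2 == 0%N)]].

(* Main.v *)
(* Call a specified zero a corner if both its row and its column contain a
   nonzero specified entry. Selecting the rows and columns of a corner and of two
   such entries, any completion of A (x) I_b contains a triangular block matrix
   of rank 2b, and a completion of the restriction of A to this triangular
   pattern has rank 2. On the other hand mr A <= 2 always holds. If there is no
   corner, every specified zero lies in a row or column without nonzero specified
   entries; filling these rows and columns with 0, a completion of rank at most 1
   is obtained by solving u_i v_j = a_ij on the nonzero entries, which is possible
   because a zero entry cuts the cycle formed by the specified positions. *)
Require Import Defs.
From HB Require Import structures.
From mathcomp Require Import all_boot all_order all_algebra.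
From mathcomp Require Import boolp classical_sets reals.
From mathcomp Require Import zify.

Set Implicit Arguments.
Unset Strict Implicit.
Unset Printing Implicit Defensive.

Import Order.TTheory GRing.Theory Num.Theory.
Local Open Scope ring_scope.

(** * Minimal ranks and rank bounds from submatrices *)

Lemma min_rank_le (F : fieldType) m n (P : 'M[F]_(m, n) -> Prop)
    (exP : exists B, P B) (B : 'M[F]_(m, n)) :
  P B -> (min_rank exP <= \rank B)%N.
Proof.
move=> PB; rewrite /min_rank; case: ex_minnP => r _; apply.
by apply/asboolP; exists B.
Qed.

Lemma min_rank_attained (F : fieldType) m n (P : 'M[F]_(m, n) -> Prop)
    (exP : exists B, P B) :
  exists2 B, P B & min_rank exP = \rank B.
Proof.
by rewrite /min_rank; case: ex_minnP => r /asboolP[B PB <-] _; exists B.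
Qed.

Lemma mxrank_mxsub (F : fieldType) m n m' n' (f : 'I_m' -> 'I_m)
    (g : 'I_n' -> 'I_n) (B : 'M[F]_(m, n)) :
  (\rank (mxsub f g B) <= \rank B)%N.
Proof.
rewrite mxsubrc; apply: leq_trans (mxrankS (rowsub_sub _ _)) _.
by rewrite -mxrank_tr -[leqRHS]mxrank_tr trmx_mxsub (mxrankS (rowsub_sub _ _)).
Qed.

Lemma mxrank_scalar (F : fieldType) b (x : F) :
  x != 0 -> \rank (x%:M : 'M_b) = b.
Proof.
by move=> x0; rewrite mxrank_unit// unitmxE det_scalar unitfE expf_neq0.
Qed.

Lemma rank_ge_scalar (F : fieldType) m n b (B : 'M[F]_(m, n)) f g (x : F) :
  x != 0 -> mxsub f g B = x%:M :> 'M_b -> (b <= \rank B)%N.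
Proof.
by move=> x0 eB; rewrite -{1}(mxrank_scalar b x0) -eB mxrank_mxsub.
Qed.

(** The selected blocks form a block lower triangular matrix with diagonal blocks [x%:M] and [z%:M];
    the block at [f'], [g'] is arbitrary. *)
Lemma rank_ge_triangle (F : fieldType) m n b (B : 'M[F]_(m, n))
    f f' g g' (x z : F) :
  x != 0 -> z != 0 -> mxsub f g B = 0%:M ->
  mxsub f g' B = x%:M -> mxsub f' g B = z%:M :> 'M_b ->
  (b + b <= \rank B)%N.
Proof.
move=> x0 z0; rewrite raddf0 => e0 ex ez.
pose h (k : 'I_(b + b)) := match split k with inl a => f a | inr a => f' a end.
pose h' (k : 'I_(b + b)) := match split k with inl a => g' a | inr a => g a end.
have eB : mxsub h h' B = block_mx x%:M 0 (mxsub f' g' B) z%:M.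
  rewrite -[LHS]submxK; congr block_mx;
    rewrite -?ex -?e0 -?ez; apply/matrixP => i j;
    by rewrite !mxE /h /h' !(unsplitK (inl _), unsplitK (inr _)).
apply: leq_trans (mxrank_mxsub h h' B); rewrite eB mxrank_unit//.
by rewrite unitmxE det_lblock !det_scalar unitfE mulf_neq0 ?expf_neq0.
Qed.

(** * Comparison of the three minimal ranks *)

Lemma triangular1 m n (p : 'I_m * 'I_n) : triangular [set p].
Proof.
apply/forall_inP => q /set1P ->; apply/forall_inP => r /set1P ->.
by case: p => i j; rewrite set11.
Qed.

Lemma triangular_corner m n (i i' : 'I_m) (j j' : 'I_n) :
  triangular [set (i, j); (i, j'); (i', j)].
Proof.
apply/forall_inP => -[k l] hp; apply/forall_inP => -[k' l'] hq.
move: hp hq; rewrite !inE !xpair_eqE /=.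
by do 2 (case/orP => [/orP[]|] /andP[/eqP-> /eqP->]); rewrite !eqxx ?orbT.
Qed.

Lemma mr_restrict (F : fieldType) m n (A : partial_matrix F m n) T :
  (mr (restrict A T) <= mr A)%N.
Proof.
have [B cB eB] := min_rank_attained (ex_completion A); rewrite [mr A]eB.
apply: min_rank_le => i j a; rewrite mxE; case: ifP => // _; exact: cB.
Qed.

Lemma tmr_le_mr (F : fieldType) m n (A : partial_matrix F m n) :
  (tmr A <= mr A)%N.
Proof. by apply/bigmax_leqP => T _; apply: mr_restrict. Qed.

(** Extend [T] to a maximal triangular [S]: completing on [S] also completes on [T]. *)
Lemma tmr_ge (F : fieldType) m n (A : partial_matrix F m n) k
    (T : {set 'I_m * 'I_n}) :
  T \subset pattern A -> triangular T ->
  (forall B, completion (restrict A T) B -> (k <= \rank B)%N) ->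
  (k <= tmr A)%N.
Proof.
move=> TA tT hk.
have [|S mS TS] := @maxset_exists _
  (fun S : {set 'I_m * 'I_n} => (S \subset pattern A) && triangular S) T.
  by rewrite TA.
apply: leq_trans (leq_bigmax_cond _ mS).
have [B cB eB] := min_rank_attained (ex_completion (restrict A S)).
rewrite [mr _]eB.
apply: hk => i j a; rewrite mxE; case: ifP => // ijT Aij.
by apply: cB; rewrite mxE (fintype.subsetP TS).
Qed.

Lemma block_mr_tensor1 (F : fieldType) m n (A : partial_matrix F m n) :
  (block_mr (tensor_id A 1) <= mr A)%N.
Proof.
have [B cB eB] := min_rank_attained (ex_completion A); rewrite [mr A]eB.
(* A block matrix has size [\sum_i 1], not [m], so [B] is rebuilt from its rank factorization, whose
   inner dimension [\rank B] bounds the rank. *)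
set C := \mxcol_i row i (col_base B) *m \mxrow_j col j (row_base B).
apply: (@leq_trans (\rank C)); last first.
  exact: leq_trans (mxrankM_maxl _ _) (rank_leq_col _).
apply: min_rank_le => i j X.
rewrite /C mul_mxcol_mxrow mxblockK /tensor_id.
case eA: (A i j) => [a|//] [<-].
rewrite -[a](cB _ _ _ eA) -[in RHS](mulmx_base B).
apply/matrixP => k l; rewrite !ord1 !mxE mulr1n.
by apply: eq_bigr => t _; rewrite !mxE.
Qed.

(** Sandwich: [tmr A <= mr A] pins both to [k]; for [fmr], [b = 1] gives the upper bound and the
    last hypothesis the lower one. *)
Lemma mr_fmr_tmr_eq (R : realType) (F : fieldType) m n
    (A : partial_matrix F m n) k :
  (mr A <= k)%N -> (k <= tmr A)%N ->
  (forall b B, block_completion (tensor_id A b) B -> (k * b <= \rank B)%N) ->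
  [/\ (mr A)%:R = fmr R A, fmr R A = (tmr A)%:R & tmr A = k].
Proof.
move=> mk kt kb; have tm := tmr_le_mr A.
have em : mr A = k by lia.
have et : tmr A = k by lia.
suff ef : fmr R A = k%:R by rewrite em et ef.
apply/eqP; rewrite eq_le; apply/andP; split.
- apply: (@le_trans _ _ ((block_mr (tensor_id A 1))%:R / 1%:R)).
    apply: ge_inf; last by exists 1%N.
    by exists 0 => _ [b _ <-]; rewrite divr_ge0 ?ler0n.
  by rewrite divr1 ler_nat -em block_mr_tensor1.
- apply: lb_le_inf; first by exists ((block_mr (tensor_id A 1))%:R / 1%:R), 1%N.
  move=> _ [b /= b0 <-]; rewrite ler_pdivlMr ?ltr0n// -natrM ler_nat.
  have [B cB eB] := min_rank_attained (ex_block_completion (tensor_id A b)).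
  rewrite [block_mr _]eB.
  exact: kb.
Qed.

(* Since [e z = 0], the walk restarts with the value 1 after step [z], so its
   final value does not depend on the initial one; the latter can therefore be
   chosen to satisfy the closing condition. *)
Lemma cycle_potential (F : fieldType) (e : nat -> F) m z :
  (z < m)%N -> e z = 0 ->
  exists2 w : nat -> F, forall k, w k != 0 &
    forall k, (k < m)%N -> e k != 0 -> w k * w (k.+1 %% m)%N = e k.
Proof.
move=> zm ez.
pose W := fix W c k : F :=
  if k is k'.+1 then (if e k' == 0 then 1 else e k' / W c k') else c.
have W0 c k : c != 0 -> W c k != 0.
  move=> c0; elim: k => //= k IH; case: (eqVneq (e k) 0) => [_|ek].
    exact: oner_neq0.
  by rewrite mulf_neq0 ?invr_neq0.
have WE c k : c != 0 -> e k != 0 -> W c k * W c k.+1 = e k.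
  by move=> c0 ek /=; rewrite (negPf ek) mulrC divfK ?W0.
have Wz c c' k : (z < k)%N -> W c k = W c' k.
  elim: k => //= k IH; rewrite ltnS leq_eqVlt => /predU1P[<-|/IH->//].
  by rewrite ez eqxx.
(* Using [W 1] instead of [W c] avoids circularity; [Wz] identifies them at [m.-1] once
   [z < m.-1]. *)
pose c := if e m.-1 == 0 then 1 else e m.-1 / W 1 m.-1.
have c0 : c != 0.
  rewrite /c; case: (eqVneq (e m.-1) 0) => [_|em]; first exact: oner_neq0.
  by rewrite mulf_neq0 ?invr_neq0 ?W0 ?oner_neq0.
exists (W c) => [k|k km ek]; first exact: W0.
have [km1|] := ltnP k.+1 m; first by rewrite modn_small ?WE.
move=> mk; have em : m = k.+1 by lia.
have zk : (z < k)%N.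
  have : z != k by apply: contraNneq ek => <-; rewrite ez.
  by lia.
rewrite em modnn [W c 0%N]/= {2}/c em /= (negPf ek) (Wz c 1)//.
by rewrite mulrC divfK ?W0 ?oner_neq0.
Qed.

(** * Upper bounds on the cycle pattern *)

Section CyclePattern.

Variables (F : fieldType) (n : nat) (A : partial_matrix F n n).
Hypothesis hA : pattern A = cycle_pattern n.

Lemma cycle_patternP i j a : A i j = Some a ->
  val j = val i \/ val j = ((val i).+1 %% n)%N.
Proof.
move=> Aij; have : (i, j) \in pattern A by rewrite inE Aij.
rewrite hA inE /= => /or3P[/eqP->|/eqP e|/andP[/eqP e /eqP->]].
- by left.
- by right; rewrite modn_small -e.
- by right; rewrite e modnn.
Qed.

Lemma cycle_mr_le1 :
  (exists i j, A i j = Some 0) ->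
  (forall i j j' i' x z, A i j = Some 0 -> A i j' = Some x ->
     A i' j = Some z -> x = 0 \/ z = 0) ->
  (mr A <= 1)%N.
Proof.
move=> [i0 [j0 A0]] corner.
pose I k := insubd i0 k.
have IE (i : 'I_n) : I i = i by rewrite /I valKd.
(* Column j is vertex 2j and row i is vertex 2i+1 of the cycle; edge k joins
   vertices k and k+1. *)
pose e k := odflt 0 (A (I k./2) (I (uphalf k %% n)%N)).
have ediag (i : 'I_n) : e i.*2 = odflt 0 (A i i).
  by rewrite /e doubleK uphalf_double modn_small ?IE.
have esup (i j : 'I_n) : val j = (i.+1 %% n)%N -> e i.*2.+1 = odflt 0 (A i j).
  by move=> ej; rewrite /e /= uphalf_double doubleK -ej !IE.
have [z zn ez] : exists2 z, (z < n.*2)%N & e z = 0.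
  have [ej|ej] := cycle_patternP A0.
    exists i0.*2; first by rewrite ltn_double.
    have eji : j0 = i0 by apply: val_inj.
    by rewrite ediag -{2}eji A0.
  exists i0.*2.+1; first by have := ltn_ord i0; lia.
  by rewrite (esup _ _ ej) A0.
have [w w0 wE] := cycle_potential zn ez.
pose rz i := `[< forall j x, A i j = Some x -> x = 0 >].
pose cz j := `[< forall i x, A i j = Some x -> x = 0 >].
pose u : 'cV_n := \col_i (if rz i then 0 else w i.*2.+1).
pose v : 'rV_n := \row_j (if cz j then 0 else w j.*2).
apply: (@leq_trans (\rank (u *m v))); last first.
  exact: leq_trans (mxrankM_maxl _ _) (rank_leq_col _).
apply: min_rank_le => i j a Aij.
rewrite mxE big_ord1 !mxE /rz /cz.
have [a0|a0] := eqVneq a 0.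
  rewrite a0 in Aij *.
  case: asboolP => [_|nr]; first by rewrite mul0r.
  case: asboolP => [_|nc]; first by rewrite mulr0.
  (* Nonzero entries in both the row and the column of this zero would make it a corner. *)
  exfalso; apply: nr => j' x Ax; apply: contrapT => x0.
  by apply: nc => i' y Ay; case: (corner _ _ _ _ _ _ Aij Ax Ay).
rewrite asboolF; last by move=> h; rewrite (h _ _ Aij) eqxx in a0.
rewrite asboolF; last by move=> h; rewrite (h _ _ Aij) eqxx in a0.
have [ej|ej] := cycle_patternP Aij.
  have eji : j = i by apply: val_inj.
  rewrite eji in Aij *.
  have := wE i.*2; rewrite ediag Aij /= mulrC => <- //; last first.
    by rewrite ltn_double.
  by rewrite modn_small//; have := ltn_ord i; lia.
have := wE i.*2.+1; rewrite (esup _ _ ej) Aij /= => <- //; last first.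
  by have := ltn_ord i; lia.
(* The vertex after [2i+1] modulo [2n] is twice [i+1] modulo [n]. *)
by congr (_ * w _); rewrite [X in X.*2]ej -doubleS -!mul2n muln_modr.
Qed.

(* Rows 0, 1, 3, 5, ... and 2, 4, 6, ... of the completion are [u + v], [u] and
   [v]: cyclically adjacent rows are then distinct, so the two prescribed
   entries of each column determine the entries of [u] and [v] there. *)
Lemma cycle_mr_le2 : (3 <= n)%N -> (mr A <= 2)%N.
Proof.
move=> hn.
pose phi k (p : F * F) :=
  if k == 0%N then p.1 + p.2 else if odd k then p.1 else p.2.
have interp (k l : nat) (a b : F) : (l = k.+1 \/ k = n.-1 /\ l = 0%N) ->
    exists p, phi k p = a /\ phi l p = b.
  move=> [->|[-> ->]].
    case: k => [|k]; first by exists (b, a - b); rewrite /phi /= addrC subrK.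
    by rewrite /phi /=; case: (odd k) => /=; [exists (b, a)|exists (a, b)].
  have -> : n.-1 = n.-2.+1 by lia.
  rewrite /phi /=.
  case: (odd n.-2) => /=; [exists (b - a, a)|exists (a, b - a)]; rewrite /=;
    by rewrite ?subrK // addrC subrK.
have col (j : 'I_n) : exists p, forall i a, A i j = Some a -> phi i p = a.
  (* Column [j] is specified exactly in row [j] and in its cyclic predecessor [j']. *)
  have j'n : ((j + n.-1) %% n < n)%N by rewrite ltn_mod; lia.
  pose j' := Ordinal j'n.
  have adj : val j = (val j').+1 \/ val j' = n.-1 /\ val j = 0%N.
    have := ltn_ord j; rewrite /=; case: (posnP j) => [->|j0] _.
      by right; rewrite add0n modn_small //; lia.
    left; have -> : (j + n.-1 = n + j.-1)%N by lia.
    by rewrite modnDl modn_small; have := ltn_ord j; lia.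
  have [p [pj' pj]] := interp _ _ (odflt 0 (A j' j)) (odflt 0 (A j j)) adj.
  exists p => i a Aij.
  have [e|e] := cycle_patternP Aij.
    have eji : j = i by apply: val_inj.
    by rewrite eji in Aij pj *; rewrite pj Aij.
  have ei : j' = i.
    apply: val_inj; have := ltn_ord i.
    rewrite leq_eqVlt => /predU1P[ei|ei]; move: e adj.
      by rewrite ei modnn; move: ei => /= ei; lia.
    by rewrite modn_small//=; lia.
  by rewrite ei in pj'; rewrite pj' Aij.
have [q qE] := choice col.
pose L (g : nat -> F) : 'cV_n := \col_i g i.
pose u : 'rV_n := \row_j (q j).1.
pose v : 'rV_n := \row_j (q j).2.
(* Each [phi k] is linear, so its values on the unit pairs are the coefficients of [u] and [v] in
   row [k]. *)
pose B := L (fun k => phi k (1, 0)) *m u + L (fun k => phi k (0, 1)) *m v.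
apply: (@leq_trans (\rank B)); last first.
  apply: leq_trans (mxrank_add _ _) _.
  by apply: (@leq_add _ _ 1 1);
    apply: leq_trans (mxrankM_maxl _ _) (rank_leq_col _).
apply: min_rank_le => i j a /qE <-.
rewrite !mxE !big_ord1 !mxE /phi /=.
by case: ifP => _; [|case: ifP => _];
  rewrite ?addr0 ?add0r ?mul1r ?mul0r ?addr0 ?add0r.
Qed.

End CyclePattern.

Theorem proposition4p1 (R : realType) (F : fieldType) (n : nat) (hn : (3 <= n)%N)
    (A : partial_matrix F n n) (hA : pattern A = cycle_pattern n)
    (h0 : exists i j, A i j = Some 0) :
  [/\ (mr A)%:R = fmr R A, fmr R A = (tmr A)%:R & (tmr A <= 2)%N].
Proof.
(* [k] is 2 if there is a corner, 1 if there is none but some specified entry is nonzero, and 0 if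
   all specified entries vanish. *)
suff [k k2 [mk kt kb]] : exists2 k, (k <= 2)%N &
    [/\ (mr A <= k)%N, (k <= tmr A)%N & forall b B,
        block_completion (tensor_id A b) B -> (k * b <= \rank B)%N].
  by have [-> -> ->] := mr_fmr_tmr_eq R mk kt kb.
have inA i j a : A i j = Some a -> (i, j) \in pattern A by rewrite inE => ->.
have one (B : 'M[F]_n) i j a :
    B i j = a -> mxsub (fun=> i) (fun=> j) B = a%:M :> 'M_1.
  by move=> <-; apply/matrixP => k l; rewrite !ord1 !mxE.
have [[i [j [j' [i' [x [z [[A0 Ax Az] [x0 z0]]]]]]]]|ncorner] := pselect
    (exists i j j' i' x z,
       [/\ A i j = Some 0, A i j' = Some x & A i' j = Some z] /\
       x != 0 /\ z != 0).
- exists 2%N => //; split; first exact: cycle_mr_le2.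
  + apply: (tmr_ge _ (triangular_corner i i' j j')) => [|B cB].
      apply/fintype.subsetP => p /setUP[/set2P[]|/set1P] ->;
        by apply: inA; eassumption.
    apply: (@rank_ge_triangle _ _ _ 1 _
      (fun=> i) (fun=> i') (fun=> j) (fun=> j') x z) => //.
    * by apply: one; apply: cB; rewrite mxE !inE eqxx ?orbT.
    * by apply: one; apply: cB; rewrite mxE !inE eqxx ?orbT.
    * by apply: one; apply: cB; rewrite mxE !inE eqxx ?orbT.
  + move=> b B cB; rewrite mul2n -addnn.
    (* Unification finds the index maps, since [submxblock] is an [mxsub]. *)
    apply: (rank_ge_triangle x0 z0);
      [apply: (cB i j)|apply: (cB i j')|apply: (cB i' j)].
    * by rewrite /tensor_id A0.
    * by rewrite /tensor_id Ax.
    * by rewrite /tensor_id Az.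
have [[i [j [x [Ax x0]]]]|nnz] :=
  pselect (exists i j x, A i j = Some x /\ x != 0).
- exists 1%N => //; split.
  + apply: (cycle_mr_le1 hA h0) => i1 j1 j1' i1' y z A0 Ay Az.
    have [->|y0] := eqVneq y 0; first by left.
    have [->|z0] := eqVneq z 0; first by right.
    by exfalso; apply: ncorner; exists i1, j1, j1', i1', y, z.
  + apply: (tmr_ge _ (triangular1 (i, j))) => [|B cB].
      by rewrite finset.sub1set (inA _ _ _ Ax).
    apply: (rank_ge_scalar x0); apply: (one B i j); apply: cB.
    by rewrite mxE set11.
  + move=> b B cB; rewrite mul1n.
    apply: (rank_ge_scalar x0); apply: (cB i j).
    by rewrite /tensor_id Ax.
exists 0%N => //; split => //; apply: leq_trans (min_rank_le _ (B := 0) _) _.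
- move=> i j a Aij; rewrite mxE; apply: contrapT => a0; apply: nnz.
  by exists i, j, a; split => //; apply/eqP => a0'; apply: a0.
- by rewrite mxrank0.
Qed.
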